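(* Let $h\geq 3$ and $k$ be positive integers, and let $A$ be a finite set of $k$ integers with $\min(A)=0$ and $\gcd(A)=1$. (1) If $k\geq 3h+1$ and $|h^{\wedge}A| = hk-h^{2}+2$, then $A\subseteq [0,k]$. (2) If $k\geq 3h+3$ and $|h^{\wedge}A| = hk-h^{2}+3$, then $A\subseteq [0,k+1]$. (3) If $k\geq 3h+4$ and $|h^{\wedge}A| = hk-h^{2}+4$, then $A\subseteq [0,k+2]$.
   Context: For a finite set $A$ of integers and a positive integer $h\le |A|$, the restricted $h$-fold sumset $h^{\wedge}A$ is the set of all sums of $h$ distinct elements of $A$. For integers $\alpha\le\beta$, $[\alpha,\beta]=\{x\in\mathbb{Z}:\alpha\le x\le\beta\}$. $\gcd(A)$ denotes the greatest common divisor of the elements of $A$. *)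

(* Defs.v *)
From HB Require Import structures.
From mathcomp Require Import all_boot all_order all_algebra.
From mathcomp Require Import finmap.

Set Implicit Arguments.
Unset Strict Implicit.
Unset Printing Implicit Defensive.

Import Order.TTheory GRing.Theory Num.Theory.

Local Open Scope fset_scope.
Local Open Scope ring_scope.

(* A sum of h distinct elements of A is the sum of the elements of an
   h-element subset of A. *)
Definition restricted_sumset (h : nat) (A : {fset int}) : {fset int} :=
  [fset \sum_(x <- (B : {fset int})) x
     | B in [fset B in fpowerset A | #|` B| == h]].

Definition is_min (A : {fset int}) (m : int) : Prop :=
  m \in A /\ forall x : int, x \in A -> m <= x.

(* The iteration is over gcdn on absolute values rather than over gcdz, because
   0 is neutral for gcdz only up to sign, so gcdz is not a monoid law on int. *)
Definition gcd_fset (A : {fset int}) : nat :=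
  \big[gcdn/0%N]_(x <- A) `|x|%N.

(* Main.v *)
Require Import Defs.
From mathcomp Require Import all_boot all_order all_algebra.
From mathcomp Require Import finmap.
From mathcomp Require Import zify.

Import Order.TTheory GRing.Theory Num.Theory.

Local Open Scope fset_scope.
Local Open Scope ring_scope.

(* Write e_h(A) for the excess of |h^A| over its minimum h(k - h) + 1, where
   k = |A|. For e <= 3 and k >= h + 2e + 4, a set with e_h(A) <= e lies in an
   arithmetic progression with k + e terms; this is proved by induction on h.

   For h = 2 and A inside [0, n] with 0, n in A, every residue modulo n is a sum
   of two distinct elements as soon as A is dense, n <= 2k - 5, and then
   e_2(A) >= n + 1 - k. Cutting A at two consecutive elements splits the excess
   between a lower and an upper block, so the bottom or the top 6 or 7 elements
   of A have excess at most 1 and form a dense core; adding the remaining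
   elements one by one, an element outside the progression of the core, or too
   far away to keep the set dense, would create an excess larger than 3.

   For h > 2, let d be the gap between the two smallest elements of A. Passing
   from A without its minimum to A, the sums exceeding min A + (sum of the top
   h - 1 elements) are numerous enough to give e_h(A) >= e_{h-1}(A \ min A)
   + (d - 1), so the excess pays for the holes below the second element. *)

Local Notation "h ^^ A" := (restricted_sumset h A) (at level 30).

(** * Elements of restricted sumsets *)

Lemma restricted_sumsetP (h : nat) (A : {fset int}) (z : int) :
  reflect (exists B : {fset int},
             [/\ B `<=` A, #|` B| = h & z = \sum_(x <- B) x])
          (z \in h ^^ A).
Proof.
apply: (iffP idP).
  case/imfsetP => B /=; rewrite !inE /= => /andP[]; rewrite fpowersetE => sBA.
  by move=> /eqP cB ->; exists B.
case=> B [sBA cB ->]; apply/imfsetP; exists B => //=.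
by rewrite !inE /= fpowersetE sBA cB eqxx.
Qed.

Lemma pair_sumP (A : {fset int}) (z : int) :
  reflect (exists x y : int, [/\ x \in A, y \in A, x < y & z = x + y])
          (z \in 2 ^^ A).
Proof.
apply: (iffP (restricted_sumsetP _ _ _)).
  case=> B [/fsubsetP sBA cB ->].
  have [x xB] : exists x, x \in B.
    by apply/fset0Pn; rewrite -cardfs_gt0 cB.
  have := cardfsD1 x B; rewrite cB xB => -[] /esym/eqP/cardfs1P[y By].
  have yB : y \in B `\ x by rewrite By in_fset1.
  have -> : \sum_(x <- B) x = x + y.
    by rewrite (big_fsetD1 x) //= By big_seq_fset1.
  move: yB; rewrite !inE => /andP[neq yB].
  case: (ltgtP x y) neq => // lt _; last by exists y, x; rewrite addrC !sBA.
  by exists x, y; rewrite !sBA.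
case=> x [y [xA yA lt ->]]; exists [fset x; y]; split.
- by apply/fsubsetP => t; rewrite !inE => /orP[]/eqP->.
- by rewrite cardfs2 (lt_eqF lt).
- by rewrite big_fsetU1 ?big_seq_fset1 // inE (lt_eqF lt).
Qed.

Lemma restricted_sumset_sub (h : nat) (A B : {fset int}) :
  A `<=` B -> h ^^ A `<=` h ^^ B.
Proof.
move=> sAB; apply/fsubsetP => z /restricted_sumsetP[C [sCA cC ->]].
by apply/restricted_sumsetP; exists C; split => //; apply: fsubset_trans sAB.
Qed.

Lemma restricted_sumset_cons (h : nat) (A : {fset int}) (x z : int) :
  x \in A -> z \in h ^^ (A `\ x) -> x + z \in h.+1 ^^ A.
Proof.
move=> xA /restricted_sumsetP[B [sBA cB ->]].
have xB : x \notin B.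
  by apply/negP => /(fsubsetP sBA); rewrite !inE eqxx.
apply/restricted_sumsetP; exists (x |` B); split.
- apply/fsubsetP => t; rewrite !inE => /orP[/eqP->//|/(fsubsetP sBA)].
  by rewrite !inE => /andP[].
- by rewrite cardfsU1 xB cB.
- by rewrite big_fsetU1.
Qed.

(** * Affine images; ratio [-1] is the reflection that exchanges minimum and maximum *)

Definition affine (m g : int) (A : {fset int}) : {fset int} :=
  [fset m + g * x | x in A].

Lemma affine_inj (m g : int) : g != 0 -> injective (fun x : int => m + g * x).
Proof. by move=> g0 x y /addrI/(mulfI g0). Qed.

Lemma card_affine (m g : int) (A : {fset int}) :
  g != 0 -> #|` affine m g A| = #|` A|.
Proof. by move=> g0; apply: card_imfset; apply: affine_inj. Qed.

Lemma mem_affine (m g : int) (A : {fset int}) (x : int) :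
  g != 0 -> (m + g * x \in affine m g A) = (x \in A).
Proof.
by move=> g0; apply: (mem_imfset _ (f := fun x => m + g * x)); apply: affine_inj.
Qed.

Lemma affineP (m g : int) (A : {fset int}) (z : int) :
  reflect (exists2 x, x \in A & z = m + g * x) (z \in affine m g A).
Proof. exact: (iffP (imfsetP _ _ _ _)). Qed.

Lemma affine_sub (m g : int) (A B : {fset int}) :
  A `<=` B -> affine m g A `<=` affine m g B.
Proof.
move=> /fsubsetP sAB; apply/fsubsetP => z /affineP[x xA ->].
by apply/affineP; exists x => //; apply: sAB.
Qed.

Lemma affineD1 (m g : int) (A : {fset int}) (a : int) :
  g != 0 -> affine m g A `\ (m + g * a) = affine m g (A `\ a).
Proof.
move=> g0; apply/fsetP => z; rewrite !inE; apply/andP/affineP.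
  case=> neq /affineP[x xA zE]; exists x => //; rewrite !inE xA andbT.
  by apply: contraNneq neq => <-; rewrite zE.
case=> x; rewrite !inE => /andP[neq xA] ->; rewrite mem_affine // xA.
by rewrite (inj_eq (affine_inj m g g0)).
Qed.

Lemma sum_affine (m g : int) (A : {fset int}) : g != 0 ->
  \sum_(x <- affine m g A) x = m *+ #|` A| + g * \sum_(x <- A) x.
Proof.
move=> g0; rewrite big_imfset /=; last by move=> x y _ _; apply: affine_inj.
rewrite big_split /= mulr_sumr; congr (_ + _).
by rewrite big_const_seq count_predT iter_addr addr0.
Qed.

Lemma restricted_sumset_affine (h : nat) (m g : int) (A : {fset int}) :
  g != 0 -> h ^^ affine m g A = affine (m *+ h) g (h ^^ A).
Proof.
move=> g0; apply/fsetP => z; apply/restricted_sumsetP/affineP; last first.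
  case=> _ /restricted_sumsetP[B [sBA cB ->]] ->; exists (affine m g B).
  by rewrite affine_sub // card_affine // sum_affine // cB.
case=> B [sBA cB zE].
have BE : B = affine m g [fset x in A | m + g * x \in B].
  apply/fsetP => x; apply/idP/affineP => [xB|[y]]; last first.
    by rewrite !inE => /andP[_ yB] ->.
  have /affineP[y yA xE] := fsubsetP sBA _ xB.
  by exists y => //; rewrite !inE yA -xE.
move: cB zE; rewrite BE card_affine // sum_affine // => cB ->.
rewrite cB; eexists; last by [].
apply/restricted_sumsetP; eexists; split; [|exact: cB|by []].
by apply/fsubsetP => x; rewrite !inE => /andP[].
Qed.

Lemma card_restricted_sumset_affine (h : nat) (m g : int) (A : {fset int}) :
  g != 0 -> #|` h ^^ affine m g A| = #|` h ^^ A|.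
Proof. by move=> g0; rewrite restricted_sumset_affine // card_affine. Qed.

(** * Intervals, extreme elements and bottom blocks *)

Definition int_range (a : int) (n : nat) : {fset int} :=
  [fset a + i%:Z | i in iota 0 n].

Lemma in_int_range (a : int) (n : nat) (x : int) :
  (x \in int_range a n) = (a <= x < a + n%:Z).
Proof.
apply/imfsetP/idP => [[i /=]|].
  by rewrite mem_iota => /andP[_ lt] ->; lia.
move=> ax; exists `|x - a|%N => /=; last by lia.
by rewrite mem_iota; lia.
Qed.

Lemma card_int_range (a : int) (n : nat) : #|` int_range a n| = n.
Proof.
rewrite card_imfset /=; last by move=> i j /addrI[].
by rewrite undup_id ?size_iota // iota_uniq.
Qed.

Lemma card_fset_le (A : {fset int}) (a : int) (n : nat) :
  (forall x, x \in A -> a <= x < a + n%:Z) -> (#|` A| <= n)%N.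
Proof.
move=> sA; rewrite -(card_int_range a n); apply: fsubset_leq_card.
by apply/fsubsetP => x /sA; rewrite in_int_range.
Qed.

Lemma fset_max (A : {fset int}) :
  (0 < #|` A|)%N -> exists2 a, a \in A & forall x, x \in A -> x <= a.
Proof.
have [n] := ubnP #|` A|; elim: n A => // n IH A; rewrite ltnS => lt.
rewrite cardfs_gt0 => /fset0Pn[a aA].
have := cardfsD1 a A; rewrite aA => cA.
have [/cardfs0_eq A0|pos] := posnP #|` A `\ a|.
  exists a => // x xA; have : x \notin A `\ a by rewrite A0.
  by rewrite !inE xA andbT negbK => /eqP->.
have [|b] := IH (A `\ a) _ pos; first by lia.
rewrite !inE => /andP[_ bA] bmax; exists (Order.max a b); first by case: leP.
move=> x xA; rewrite le_max; have [->|neq] := eqVneq x a; first by rewrite lexx.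
by rewrite orbC bmax // !inE neq.
Qed.

Lemma fset_min (A : {fset int}) :
  (0 < #|` A|)%N -> exists2 a, a \in A & forall x, x \in A -> a <= x.
Proof.
move=> A0; have [|b /affineP[a aA ->] amin] := fset_max (affine 0 (-1) A).
  by rewrite card_affine.
exists a => // x xA.
by have := amin (0 + -1 * x); rewrite mem_affine // => /(_ xA); lia.
Qed.

Lemma fset_bottom (A : {fset int}) (c : nat) : (c <= #|` A|)%N ->
  exists B : {fset int}, [/\ B `<=` A, #|` B| = c &
    forall x y, x \in B -> y \in A -> y \notin B -> x < y].
Proof.
elim: c => [|c IH] cA.
  by exists fset0; split; rewrite ?fsub0set ?cardfs0.
have [|B [sBA cB Blt]] := IH; first by lia.
have [|a] := fset_min (A `\` B).
  by rewrite cardfsDS //; lia.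
rewrite inE => /andP[aB aA] amin; exists (a |` B); split.
- by apply/fsubsetP => t; rewrite !inE => /orP[/eqP->//|/(fsubsetP sBA)].
- by rewrite cardfsU1 aB cB.
- move=> x y; rewrite !inE => /orP[/eqP->|xB] yA; last first.
    by case/norP=> _; apply: Blt.
  by case/norP=> neq yB; rewrite lt_neqAle eq_sym neq amin // inE yB.
Qed.

(** * The lower bound for restricted sumsets *)

(** Subtract [v] from every element; equal cardinalities make the total shift the same on both
    sides. The common part cancels, the rest of [C] becomes nonpositive and the rest of [R]
    nonnegative. *)
Lemma sum_le_top (R C : {fset int}) (v : int) :
  #|` C| = #|` R| -> (forall x, x \in R -> v <= x) ->
  (forall x, x \in C -> x \notin R -> x <= v) ->
  \sum_(x <- C) x <= \sum_(x <- R) x.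
Proof.
move=> cCR Rv Cv.
have shift (X : {fset int}) :
    \sum_(x <- X) x = \sum_(x <- X) (x - v) + v *+ #|` X|.
  rewrite sumrB [in X in _ - X]big_const_seq count_predT iter_addr addr0.
  by rewrite subrK.
rewrite !shift cCR lerD2r.
rewrite (big_fsetID _ (mem R) C) [leRHS](big_fsetID _ (mem C) R) /=.
have -> : [fset x in C | x \in mem R] = [fset x in R | x \in mem C].
  by apply/fsetP => x; rewrite !inE andbC.
rewrite lerD2l; apply: (@le_trans _ _ 0).
  rewrite big_seq; apply: sumr_le0 => x; rewrite !inE => /andP[xC xR].
  by rewrite subr_le0 Cv.
rewrite big_seq; apply: sumr_ge0 => x; rewrite !inE => /andP[xR _].
by rewrite subr_ge0 Rv.
Qed.

Lemma cardfsD2 (T : choiceType) (A : {fset T}) (x y : T) :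
  x \in A -> y \in A -> x != y -> (#|` A `\ x `\ y| + 2 = #|` A|)%N.
Proof.
move=> xA yA neq; rewrite (cardfsD1 x A) xA (cardfsD1 y (A `\ x)).
by rewrite !inE eq_sym neq yA !add1n addn2.
Qed.

(** [R] holds the [h] largest elements of [A], so adding [a] to a sum of [h] other elements never
    exceeds [a] plus the sum of [R], while every [y] in [Y] yields a sum beyond that. The two
    families are therefore disjoint. *)
Lemma card_restricted_sumset_step (h : nat) (A R Y : {fset int}) (a v : int) :
  a \in A -> R `<=` A -> #|` R| = h ->
  (forall x, x \in R -> v <= x) ->
  (forall x, x \in A -> x \notin R -> x <= v) ->
  (forall y, y \in Y -> a < y /\ y + \sum_(x <- R) x \in h.+1 ^^ A) ->
  (#|` h ^^ (A `\ a)| + #|` Y| <= #|` h.+1 ^^ A|)%N.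
Proof.
move=> aA sRA cR Rv Av YA; set s := \sum_(x <- R) x.
rewrite -(card_affine a 1 (h ^^ (A `\ a))) // -(card_affine s 1 Y) //.
rewrite -cardfsUI [X in (_ + #|` X|)%N](_ : _ = fset0).
  rewrite cardfs0 addn0; apply: fsubset_leq_card; apply/fsubsetP => z.
  rewrite inE => /orP[/affineP[x xA ->]|/affineP[y /YA[_ yA] ->]].
    by rewrite mul1r restricted_sumset_cons.
  by rewrite mul1r addrC.
apply/fsetP => z; rewrite !inE; apply/negP => /andP[/affineP[x]].
case/restricted_sumsetP => C [/fsubsetP sCA cC ->] -> /affineP[y /YA[ay _]].
have le : \sum_(i <- C) i <= s.
  apply: (sum_le_top _ _ v); rewrite ?cC ?cR // => i /sCA.
  by rewrite !inE => /andP[_ iA]; apply: Av.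
by rewrite !mul1r; lia.
Qed.

Lemma card_restricted_sumsetD_min (h : nat) (A : {fset int}) (a : int) :
  a \in A -> (forall x, x \in A -> a <= x) -> (h < #|` A|)%N ->
  (#|` h ^^ (A `\ a)| + (#|` A| - h.+1) <= #|` h.+1 ^^ A|)%N.
Proof.
move=> aA amin hA; have [|B [sBA cB Blt]] := fset_bottom A (#|` A| - h).
  by lia.
have [|v vB vmax] := fset_max B; first by lia.
have aB : a \in B.
  apply: contraT => aB; have := Blt _ _ vB aA aB.
  by rewrite ltNge amin // (fsubsetP sBA).
have -> : (#|` A| - h.+1 = #|` B `\ a|)%N.
  by have := cardfsD1 a B; rewrite aB cB; lia.
apply: (card_restricted_sumset_step _ _ (A `\` B) _ a v) => //.
- exact: fsubsetDl.
- by rewrite cardfsDS // cB; lia.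
- by move=> x; rewrite !inE => /andP[xB xA]; apply/ltW/Blt.
- by move=> x xA; rewrite !inE xA andbT negbK => /vmax.
move=> y; rewrite !inE => /andP[neq yB]; have yA := fsubsetP sBA _ yB.
split; first by rewrite lt_neqAle eq_sym neq amin.
apply: restricted_sumset_cons => //.
apply/restricted_sumsetP; exists (A `\` B); split=> //.
  apply/fsubsetP => x; rewrite !inE => /andP[xB ->]; rewrite andbT.
  by apply: contraNneq xB => ->.
by rewrite cardfsDS // cB; lia.
Qed.

(** Induction on [h], deleting the minimum. The difference between |A| and [h] stays constant along
    the way, so every deletion gains the same number of sums. *)
Lemma card_restricted_sumset_ge (h : nat) (A : {fset int}) :
  (h <= #|` A|)%N -> (h * (#|` A| - h) + 1 <= #|` h ^^ A|)%N.
Proof.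
elim: h A => [|h IH] A hA.
  rewrite mul0n add0n cardfs_gt0; apply/fset0Pn; exists 0.
  apply/restricted_sumsetP; exists fset0; split; rewrite ?fsub0set //.
  by rewrite big_seq_fset0.
have [|a aA amin] := fset_min A; first by lia.
have cA := cardfsD1 a A; rewrite aA in cA.
have := card_restricted_sumsetD_min h A a aA amin hA.
have := IH (A `\ a); rewrite (_ : #|` A `\ a| = #|` A|.-1); last by lia.
move=> /(_ ltac:(lia)) IHA; rewrite (_ : (#|` A| - h.+1 = #|` A|.-1 - h)%N).
  by rewrite mulSn; lia.
by lia.
Qed.

Lemma card_restricted_sumsetD_max (h : nat) (A : {fset int}) (a : int) :
  a \in A -> (forall x, x \in A -> x <= a) -> (h < #|` A|)%N ->
  (#|` h ^^ (A `\ a)| + (#|` A| - h.+1) <= #|` h.+1 ^^ A|)%N.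
Proof.
move=> aA amax hA; have g0 : (-1 : int) != 0 by [].
have := card_restricted_sumsetD_min h (affine 0 (-1) A) (0 + -1 * a).
rewrite mem_affine // affineD1 // card_restricted_sumset_affine //.
rewrite card_restricted_sumset_affine // card_affine // => /(_ aA).
by apply=> // z /affineP[x /amax xa ->]; rewrite lerD2l !mulN1r lerN2.
Qed.

(** * Pair sums of dense sets *)

Lemma card_pair_sums_add_max (B N : {fset int}) (a : int) :
  (forall x, x \in B -> x < a) -> N `<=` B ->
  (forall x, x \in N -> a + x \notin 2 ^^ B) ->
  (#|` 2 ^^ B| + #|` N| <= #|` 2 ^^ (a |` B)|)%N.
Proof.
move=> Ba /fsubsetP sNB Nnew; rewrite -(card_affine a 1 N) // -cardfsUI.
rewrite [X in (_ + #|` X|)%N](_ : _ = fset0).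
  rewrite cardfs0 addn0; apply: fsubset_leq_card; apply/fsubsetP => z.
  rewrite inE => /orP[|/affineP[x /sNB xB ->]].
    by apply/fsubsetP/restricted_sumset_sub/fsubsetP => x; rewrite !inE orbC => ->.
  apply/pair_sumP; exists x, a; rewrite !inE eqxx xB orbT.
  by rewrite Ba // mul1r addrC.
apply/fsetP => z; rewrite !inE; apply/negP => /andP[zB /affineP[x /Nnew]].
by rewrite mul1r => /[swap] <-; rewrite zB.
Qed.

(* The two kinds of pairs with sum congruent to r modulo n are exchanged by the
   involution x |-> r - x, resp. x |-> n + r - x, of ]0, n[ \ {r}; B meets its
   own image in at least three points, of which at most two are fixed. *)
Lemma pair_sum_mod (B : {fset int}) (n r : int) :
  0 \in B -> n \in B -> (forall x, x \in B -> 0 <= x <= n) ->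
  n + 5 <= 2 * #|` B|%:Z -> 0 < r < n ->
  (r \in 2 ^^ B) || (n + r \in 2 ^^ B).
Proof.
move=> B0 Bn Bbd cB rn.
have [rB|rB] := boolP (r \in B).
  apply/orP; left; apply/pair_sumP; exists 0, r.
  by rewrite add0r rB; split=> //; lia.
pose X : {fset int} := B `\ 0 `\ n.
pose s (x : int) : int := if x < r then r - x else n + r - x.
have Xbd x : x \in X -> [/\ x \in B, 0 < x < n & x != r].
  rewrite !inE => /and3P[xn x0 xB]; have := Bbd _ xB.
  by split=> //; [lia|apply: contraNneq rB => <-].
have cX : (#|` X| + 2 = #|` B|)%N by apply: cardfsD2 => //; lia.
have s_inj : {in X &, injective s}.
  move=> x y /Xbd[_ xbd xr] /Xbd[_ ybd yr]; rewrite /s.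
  by case: (ltP x r); case: (ltP y r); lia.
pose sX : {fset int} := [fset s x | x in X].
have csX : #|` sX| = #|` X| by apply: card_in_imfset.
have cU : (#|` X `|` sX| + 2 <= `|n|)%N.
  have : X `|` sX `<=` int_range 1 `|n - 1| `\ r.
    apply/fsubsetP => z; rewrite inE => /orP[/Xbd[_ zbd zr]|].
      by rewrite !inE zr in_int_range; lia.
    case/imfsetP => x /= /Xbd[_ xbd xr] ->; rewrite !inE in_int_range /s.
    by case: (ltP x r); lia.
  move/fsubset_leq_card; have := cardfsD1 r (int_range 1 `|n - 1|).
  by rewrite in_int_range card_int_range; lia.
have := cardfsUI X sX; rewrite csX => cUI.
(* A fixed point of [s] satisfies 2x = r or 2x = n + r, hence lies in [F]; with the wrong parity the
   floor merely adds a harmless element. *)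
pose F : {fset int} := [fset (r %/ 2)%Z; ((n + r) %/ 2)%Z].
have cF : (#|` F| <= 2)%N by rewrite cardfs2; case: (_ == _).
have : (0 < #|` (X `&` sX) `\` F|)%N.
  rewrite cardfsD; have := fsubset_leq_card (fsubsetIr (X `&` sX) F); lia.
rewrite cardfs_gt0 => /fset0Pn[x].
rewrite in_fsetD in_fsetI in_fset2 => /and3P[xF xX].
case/imfsetP => y /= yX xE.
have [xB xbd xr] := Xbd _ xX; have [yB ybd yr] := Xbd _ yX.
have neq : x != y.
  apply: contra xF => /eqP xy; move: xE; rewrite -xy /s.
  by case: ifP => _ xE; apply/orP; [left|right]; apply/eqP; clear -xE; lia.
have xy : x + y \in 2 ^^ B.
  apply/pair_sumP; case: (ltgtP x y) neq => // lt _; first by exists x, y.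
  by exists y, x; rewrite addrC.
have [->|->] : r = x + y \/ n + r = x + y.
- by move: xE; rewrite /s; case: ifP => _ ->; [left|right]; rewrite subrK.
- by rewrite xy.
- by rewrite xy orbT.
Qed.

(* Each residue r modulo n with 0 < r < n is represented by r or by n + r, and by
   both when r lies in B. *)
Lemma card_pair_sums_dense (B : {fset int}) (n : int) :
  0 \in B -> n \in B -> (forall x, x \in B -> 0 <= x <= n) ->
  n + 5 <= 2 * #|` B|%:Z -> n + #|` B|%:Z <= #|` 2 ^^ B|%:Z + 2.
Proof.
move=> B0 Bn Bbd cB; have [n0|n0] := leP n 0.
  have := card_fset_le B 0 1; have : n = 0 by have := Bbd _ B0; lia.
  move=> nE /(_ _) cB1; suff : (#|` B| <= 1)%N by lia.
  by apply: cB1 => x /Bbd; lia.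
pose X : {fset int} := B `\ 0 `\ n.
have cX : (#|` X| + 2 = #|` B|)%N by apply: cardfsD2 => //; lia.
(* [L] and [H] hold the residues represented below and above [n]; the sum [n] = 0 + n itself belongs
   to neither and accounts for the 1 in [cLH]. *)
pose L : {fset int} := [fset z in 2 ^^ B | z < n].
pose H : {fset int} := affine (- n) 1 [fset z in 2 ^^ B | n < z].
have memH r : (r \in H) = (0 < r) && (n + r \in 2 ^^ B).
  rewrite [in LHS](_ : r = - n + 1 * (n + r)); last by rewrite mul1r addKr.
  by rewrite mem_affine // !inE andbC ltrDl.
have cLH : (#|` L| + #|` H| + 1 = #|` 2 ^^ B|)%N.
  have n2 : n \in 2 ^^ B by apply/pair_sumP; exists 0, n; rewrite add0r.
  have := cardfsD1 n (2 ^^ B); rewrite n2 => ->.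
  rewrite card_affine // -(cardfsID L (_ `\ n)).
  have -> : (2 ^^ B `\ n) `&` L = L.
    apply/fsetP => z; rewrite !inE; case: (z \in _); rewrite ?andbF //= andbT.
    by lia.
  rewrite (_ : 2 ^^ B `\ n `\` L = [fset z in 2 ^^ B | n < z]); first by lia.
  by apply/fsetP => z; rewrite !inE; case: (z \in _); rewrite ?andbF //=; lia.
have cU : (#|` int_range 1 (absz (n - 1))| <= #|` L `|` H|)%N.
  apply: fsubset_leq_card; apply/fsubsetP => r; rewrite in_int_range => rbd.
  have rn : 0 < r < n by lia.
  have := pair_sum_mod _ _ _ B0 Bn Bbd cB rn; rewrite in_fsetU memH !inE.
  by case/orP => ->; apply/orP; [left|right]; lia.
have cI : (#|` X| <= #|` L `&` H|)%N.
  apply: fsubset_leq_card; apply/fsubsetP => x; rewrite !inE memH.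
  case/and3P => xn x0 xB; have xbd := Bbd _ xB; apply/andP; split.
    apply/andP; split; last by lia.
    by apply/pair_sumP; exists 0, x; rewrite add0r; split=> //; lia.
  apply/andP; split; first by lia.
  by apply/pair_sumP; exists x, n; rewrite addrC; split=> //; lia.
have := cardfsUI L H; rewrite card_int_range in cU; lia.
Qed.

(** * Sums of two elements *)

(* A lies in an arithmetic progression of difference g with L + 1 terms. *)
Definition within (g L : int) (A : {fset int}) : Prop :=
  0 < g /\ forall x y, x \in A -> y \in A -> (g %| x - y)%Z /\ x - y <= g * L.

Lemma within_sub (g L : int) (A B : {fset int}) :
  B `<=` A -> within g L A -> within g L B.
Proof.
by move=> /fsubsetP sBA [g0 gA]; split=> // x y /sBA xA /sBA; apply: gA.
Qed.

Lemma within_progression (a g L : int) (A : {fset int}) : 0 < g ->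
  (forall x, x \in A -> exists2 q, 0 <= q <= L & x = a + g * q) ->
  within g L A.
Proof.
move=> g0 Aq; split=> // x y /Aq[p pL ->] /Aq[q qL ->].
rewrite opprD addrACA subrr add0r -mulrBr dvdz_mulr ?dvdzz //; split=> //.
by rewrite ler_pM2l //; lia.
Qed.

Lemma within_affine (m g g' L : int) (A : {fset int}) :
  g != 0 -> within g' L A -> within (`|g| * g') L (affine m g A).
Proof.
move=> g0 [g'0 Ag']; split; first by rewrite mulr_gt0 // normr_gt0.
move=> _ _ /affineP[x xA ->] /affineP[y yA ->].
have [dv le] := Ag' x y xA yA; have [_ le'] := Ag' y x yA xA.
rewrite opprD addrACA subrr add0r -mulrBr dvdz_mul //; last first.
  by rewrite dvdzE -abszE absz_nat.
split=> //; rewrite -mulrA; apply: le_trans (ler_norm _) _.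
by rewrite normrM ler_wpM2l // ler_norml; lia.
Qed.

Lemma lattice_affine (a g : int) (A : {fset int}) :
  (forall x, x \in A -> (g %| x - a)%Z) -> exists A1, A = affine a g A1.
Proof.
move=> Ag; pose A1 : {fset int} := [fset ((x - a) %/ g)%Z | x in A].
have A1K x : x \in A -> x = a + g * ((x - a) %/ g)%Z.
  by move=> xA; rewrite mulrC divzK ?Ag // addrC subrK.
exists A1; apply/fsetP => x; apply/idP/affineP => [xA|].
  by exists ((x - a) %/ g)%Z; [apply/imfsetP; exists x|apply: A1K].
by case=> q /imfsetP[y /= yA ->] ->; rewrite -A1K.
Qed.

Lemma within_normalize (a g L : int) (A : {fset int}) :
  within g L A -> a \in A -> (forall x, x \in A -> a <= x) ->
  exists2 A1 : {fset int},
    A = affine a g A1 & forall x, x \in A1 -> 0 <= x <= L.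
Proof.
move=> [g0 gA] aA amin; have gn0 : g != 0 by rewrite gt_eqF.
have [|A1 AE] := lattice_affine a g A.
  by move=> x xA; have [] := gA x a xA aA.
exists A1 => // q qA1; have qA : a + g * q \in A by rewrite AE mem_affine.
have [_] := gA _ a qA aA; have := amin _ qA.
by rewrite lerDl addrC addKr pmulr_rge0 // ler_pM2l // => -> ->.
Qed.

Lemma sub_affine (m g : int) (A1 C : {fset int}) : g != 0 ->
  C `<=` affine m g A1 -> exists2 C1, C1 `<=` A1 & C = affine m g C1.
Proof.
move=> g0 /fsubsetP sC; exists [fset x in A1 | m + g * x \in C].
  by apply/fsubsetP => x; rewrite !inE => /andP[].
apply/fsetP => x; apply/idP/affineP => [xC|[y]]; last first.
  by rewrite !inE => /andP[_ yC] ->.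
have /affineP[y yA xE] := sC _ xC.
by exists y => //; rewrite !inE yA -xE.
Qed.

(* a, ..., e are the gaps of x0 < ... < x5, and Pij says that x_i + x_j belongs to
   the chain of sums x0 + x_j (j <= 5), x_i + x5 (i >= 1). With at most ten sums
   in total, at most one value lies outside this chain of nine. *)
Lemma six_gaps (a b c d e : int) (P12 P13 P14 P23 P24 P34 : Prop) :
  0 < a -> 0 < b -> 0 < c -> 0 < d -> 0 < e ->
  (P12 -> a = c \/ a = c + d \/ a = c + d + e) ->
  (P13 -> a = d \/ a = d + e) ->
  (P14 -> a = e) ->
  (P23 -> a + b = d \/ a + b = d + e \/ b = d + e) ->
  (P24 -> a + b = e \/ b = e) ->
  (P34 -> a + b + c = e \/ b + c = e \/ c = e) ->
  P12 \/ P34 -> P12 \/ P14 -> P13 \/ P14 -> P13 \/ P24 ->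
  P14 \/ P24 -> P14 \/ P34 -> P13 \/ P34 -> P13 \/ P23 ->
  P12 \/ P24 -> P23 \/ P24 -> P14 \/ P23 \/ b = d ->
  exists g, 0 < g /\ (a, b, c, d, e) \in
    [:: (g, g, g, g, g); (g, g, g, g, g + g); (g, g, g, g + g, g);
        (g, g + g, g, g, g); (g + g, g, g, g, g)].
Proof.
move=> a0 b0 c0 d0 e0 c12 c13 c14 c23 c24 c34.
move=> q1 q2 q3 q4 q5 q6 q7 q8 q9 q10 q11.
have [ae|/eqP ae] := eqVneq a e.
  exists a; split=> //; rewrite !inE !xpair_eqE !eqxx /= -ae.
  clear c14 q2 q3 q5 q6 q11.
  case: q4 => [/c13 p|/c24 p].
    have {}p : a = d by clear -p ae e0 d0; lia.
    case: q9 => [/c12 r|/c24 r].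
      have {}r : a = c by clear -p r ae e0 c0 d0; lia.
      case: q10 => [/c23 s|/c24 s]; clear -p r s ae a0 b0; last by lia.
      by lia.
    have {}r : a = b by clear -p r ae e0 b0; lia.
    case: q1 => [/c12 s|/c34 s]; clear -p r s ae a0 b0 c0; lia.
  have {}p : a = b by clear -p ae b0; lia.
  case: q7 => [/c13 r|/c34 r].
    have {}r : a = d by clear -r ae e0 d0; lia.
    case: q1 => [/c12 s|/c34 s]; clear -p r s ae a0 b0 c0; lia.
  have {}r : a = c by clear -p r ae c0 b0 a0; lia.
  case: q8 => [/c13 s|/c23 s]; clear -p r s ae a0 b0 c0 d0; first by lia.
  by lia.
(* Without [P14], the disjunctions that contain it force [P12], [P13], [P24] and [P34]; the doubled
   gap is then the last or the first one. *)
have n14 : ~ P14 by move/c14.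
case: q2 => // /c12 p12; case: q3 => // /c13 p13.
case: q5 => // /c24 p24; case: q6 => // /c34 p34.
have q : a + b = d \/ a + b = d + e \/ b = d + e \/ b = d.
  by case: q11 => [//|[/c23[|[|]]|]]; auto.
clear -a0 b0 c0 d0 e0 ae q p12 p13 p24 p34.
case: p13 => p13.
  have ca : a = c by clear q p34; lia.
  have e_ab : a + b = e by clear q p12; lia.
  have ba : b = d by clear p34 p12 p24; lia.
  have bE : b = a by rewrite ba -p13.
  have eE : e = a + a by rewrite -e_ab bE.
  by exists a; rewrite -ca -p13 bE eE; split=> //; rewrite 2!in_cons eqxx orbT.
have be : b = e by clear q p12 p34; lia.
have ce : c = e by clear q p12; lia.
have bd : b = d by clear p34 p12 p24; lia.
have aE : a = b + b by clear q p24 p34; lia.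
exists b; rewrite ce -bd -be aE; split=> //.
by rewrite 4!in_cons mem_seq1 eqxx !orbT.
Qed.

(** Two sums outside the chain [ch] of nine would make eleven, so of any two distinct pair sums one
    is in the chain. By [six_gaps] the gaps are then equal, up to one doubled gap. *)
Lemma six_pair_sums (C : {fset int}) :
  #|` C| = 6 -> (#|` 2 ^^ C| <= 10)%N -> exists g, within g 6 C.
Proof.
move=> cC cS; pose s : seq int := sort <=%R C.
have s_sorted : sorted <%R s by rewrite sort_lt_sorted fset_uniq.
have size_s : size s = 6 by rewrite size_sort.
have mem_s x : (x \in C) = (x \in s) by rewrite mem_sort.
case: s s_sorted size_s mem_s => [|x0 [|x1 [|x2 [|x3 [|x4 [|x5 []]]]]]] //=.
case/and5P=> x01 x12 x23 x34 /andP[x45 _] _ mem_s.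
pose ch := [:: x0 + x1; x0 + x2; x0 + x3; x0 + x4; x0 + x5;
               x1 + x5; x2 + x5; x3 + x5; x4 + x5].
have ch_uniq : uniq ch.
  by apply: lt_sorted_uniq; rewrite /= !ltrD2l !ltrD2r x01 x12 x23 x34 x45.
have pairS x y : x \in C -> y \in C -> x < y -> x + y \in 2 ^^ C.
  by move=> xC yC lt; apply/pair_sumP; exists x, y.
have chS : {subset ch <= 2 ^^ C}.
  by apply/allP; rewrite /= !pairS // ?mem_s ?inE ?eqxx ?orbT //; lia.
have two u v : u \in 2 ^^ C -> v \in 2 ^^ C -> u != v -> u \in ch \/ v \in ch.
  move=> uS vS neq; apply/orP; apply: contraLR cS; rewrite negb_or -ltnNge.
  case/andP=> uch vch; apply: (@uniq_leq_size _ (u :: v :: ch)).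
    by rewrite cons_uniq in_cons negb_or neq uch cons_uniq vch.
  by move=> w; rewrite !in_cons => /or3P[/eqP->|/eqP->|/chS].
have := six_gaps (x1 - x0) (x2 - x1) (x3 - x2) (x4 - x3) (x5 - x4)
  (x1 + x2 \in ch) (x1 + x3 \in ch) (x1 + x4 \in ch)
  (x2 + x3 \in ch) (x2 + x4 \in ch) (x3 + x4 \in ch).
rewrite !subr_gt0 => /(_ x01 x12 x23 x34 x45).
have [x13 x14 x24] : [/\ x1 < x3, x1 < x4 & x2 < x4] by split; lia.
have S12 : x1 + x2 \in 2 ^^ C by rewrite pairS // mem_s !inE eqxx ?orbT.
have S13 : x1 + x3 \in 2 ^^ C by rewrite pairS // mem_s !inE eqxx ?orbT.
have S14 : x1 + x4 \in 2 ^^ C by rewrite pairS // mem_s !inE eqxx ?orbT.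
have S23 : x2 + x3 \in 2 ^^ C by rewrite pairS // mem_s !inE eqxx ?orbT.
have S24 : x2 + x4 \in 2 ^^ C by rewrite pairS // mem_s !inE eqxx ?orbT.
have S34 : x3 + x4 \in 2 ^^ C by rewrite pairS // mem_s !inE eqxx ?orbT.
(* These two sums may coincide, which is the alternative of equal second and fourth gaps; the other
   ten pairs to compare are strictly ordered. *)
have last : x1 + x4 \in ch \/ x2 + x3 \in ch \/ x2 - x1 = x4 - x3.
  have [eq14|neq] := eqVneq (x1 + x4) (x2 + x3); first by right; right; lia.
  by have [] := two _ _ S14 S23 neq; auto.
case; try by [exact: last | apply: two => //; lia |
              clear -x01 x12 x23 x34 x45; rewrite !inE; lia].
move=> g [g0 pat]; exists g.
(* [c] lists the positions of [x1], ..., [x5] in the progression from [x0]; a doubled gap skips one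
   position. *)
suff [c [Ec cL]] : exists c : int * int * int * int * int,
    [/\ x1 = x0 + g * c.1.1.1.1, x2 = x0 + g * c.1.1.1.2, x3 = x0 + g * c.1.1.2,
        x4 = x0 + g * c.1.2 & x5 = x0 + g * c.2] /\
    [/\ 0 <= c.1.1.1.1 <= 6, 0 <= c.1.1.1.2 <= 6, 0 <= c.1.1.2 <= 6,
        0 <= c.1.2 <= 6 & 0 <= c.2 <= 6].
  apply: (within_progression x0) => // x.
  case: Ec => E1 E2 E3 E4 E5; case: cL => L1 L2 L3 L4 L5.
  rewrite mem_s !inE => /or4P[|||/or3P[]] /eqP->.
  - by exists 0; rewrite ?mulr0 ?addr0.
  - by exists c.1.1.1.1.
  - by exists c.1.1.1.2.
  - by exists c.1.1.2.
  - by exists c.1.2.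
  - by exists c.2.
move: pat; clear -g0; rewrite !in_cons in_nil orbF !xpair_eqE.
case/orP=> [|/or4P[]] /andP[/andP[/andP[/andP[/eqP e1 /eqP e2] /eqP e3] /eqP e4] /eqP e5].
- by exists (1, 2, 3, 4, 5); split; split=> //=; lia.
- by exists (1, 2, 3, 4, 6); split; split=> //=; lia.
- by exists (1, 2, 3, 5, 6); split; split=> //=; lia.
- by exists (1, 3, 4, 5, 6); split; split=> //=; lia.
- by exists (2, 3, 4, 5, 6); split; split=> //=; lia.
Qed.

(** * Growing a set upwards from a bottom block *)

(** [A] is built from its bottom block [C] by adding the remaining elements in increasing order; the
    proof strips the maximum of [A] until only [C] is left. *)
Lemma fset_bottom_ind (C A : {fset int}) (P : {fset int} -> Prop) :
  C `<=` A -> (forall x y, x \in C -> y \in A -> y \notin C -> x < y) ->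
  P C ->
  (forall (B : {fset int}) (a : int), C `<=` B -> B `<=` A -> a \in A ->
     (forall x, x \in B -> x < a) -> P B -> P (a |` B)) ->
  P A.
Proof.
have [n] := ubnP #|` A `\` C|; elim: n A => // n IH A; rewrite ltnS => lt.
move=> sCA Clt PC PU; have [|pos] := posnP #|` A `\` C|.
  by move/cardfs0_eq/eqP; rewrite fsetD_eq0 => sAC; have -> : A = C
    by apply/eqP; rewrite eqEfsubset sAC.
have [a aAC amax] := fset_max _ pos; move: (aAC); rewrite inE => /andP[aC aA].
have sCB : C `<=` A `\ a.
  apply/fsubsetP => x xC; rewrite !inE (fsubsetP sCA) // andbT.
  by apply: contraNneq aC => <-.
have sBA : A `\ a `<=` A by apply: fsubD1set.
have alt x : x \in A `\ a -> x < a.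
  rewrite !inE => /andP[neq xA]; have [xC|xC] := boolP (x \in C).
    exact: Clt.
  by rewrite lt_neqAle neq amax // inE xC.
rewrite -(fsetD1K aA); apply: (PU) => //; apply: IH => //.
- have := cardfsD1 a (A `\` C); rewrite aAC.
  rewrite (_ : (A `\` C) `\ a = (A `\ a) `\` C); first by lia.
  by apply/fsetP => x; rewrite !inE andbCA.
- by move=> x y xC; rewrite !inE => /andP[_ yA]; apply: Clt.
- move=> B b sC sB bA; apply: PU => //; first exact: fsubset_trans sBA.
  exact: (fsubsetP sBA).
Qed.

Lemma fset_top2 (B : {fset int}) : (2 <= #|` B|)%N ->
  exists b b', [/\ b \in B, b' \in B, b' < b &
                   forall x, x \in B -> x = b \/ x <= b'].
Proof.
move=> cB; have [|b bB bmax] := fset_max B; first by lia.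
have := cardfsD1 b B; rewrite bB => cB1.
have [|b'] := fset_max (B `\ b); first by lia.
rewrite !inE => /andP[neq b'B] b'max; exists b, b'; split=> //.
  by rewrite lt_neqAle neq bmax.
move=> x xB; have [->|xb] := eqVneq x b; first by left.
by right; apply: b'max; rewrite !inE xb.
Qed.

Lemma pair_sums_le (B : {fset int}) (b b' z : int) :
  b' < b -> (forall x, x \in B -> x = b \/ x <= b') ->
  z \in 2 ^^ B -> z <= b + b'.
Proof.
move=> lt Bb /pair_sumP[x [y [/Bb xB /Bb yB xy ->]]].
by clear -lt xB yB xy; lia.
Qed.

(** No pair sum of [B] exceeds [b + b'], so whatever [a] produces beyond this value is new. *)
Lemma card_pair_sums_add_top (B : {fset int}) (a b b' : int) :
  b' < b -> (forall x, x \in B -> x = b \/ x <= b') ->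
  (forall x, x \in B -> x < a) ->
  (#|` 2 ^^ B| + #|` [fset x in B | (b + b' < a + x)%R]| <= #|` 2 ^^ (a |` B)|)%N.
Proof.
move=> lt Bb Ba; apply: card_pair_sums_add_max => //.
  by apply/fsubsetP => x; rewrite !inE => /andP[].
move=> x; rewrite !inE => /andP[_]; rewrite ltNge; apply: contra.
exact: pair_sums_le.
Qed.

Lemma card_pair_sums_add (B : {fset int}) (a : int) :
  (2 <= #|` B|)%N -> (forall x, x \in B -> x < a) ->
  (#|` 2 ^^ B| + 2 <= #|` 2 ^^ (a |` B)|)%N.
Proof.
move=> cB Ba; have [b [b' [bB b'B lt Bb]]] := fset_top2 B cB.
apply: leq_trans (card_pair_sums_add_top B a b b' lt Bb Ba); rewrite leq_add2l.
apply: (@leq_trans #|` [fset b; b']|); first by rewrite cardfs2 (gt_eqF lt).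
apply: fsubset_leq_card; apply/fsubsetP => x; rewrite !inE.
by have := Ba b bB; move=> ba /orP[] /eqP->; rewrite ?bB ?b'B /=; lia.
Qed.

(** The excess of a bottom block is at most that of [A]: each new maximum creates at least two sums,
    with the two largest elements before it. *)
Lemma card_pair_sums_bottom (C A : {fset int}) :
  C `<=` A -> (forall x y, x \in C -> y \in A -> y \notin C -> x < y) ->
  (2 <= #|` C|)%N ->
  (#|` 2 ^^ C| + 2 * #|` A| <= #|` 2 ^^ A| + 2 * #|` C|)%N.
Proof.
move=> sCA Clt cC; apply: (fset_bottom_ind C A (fun B =>
  (#|` 2 ^^ C| + 2 * #|` B| <= #|` 2 ^^ B| + 2 * #|` C|)%N) sCA Clt) => //.
move=> B a sCB _ _ Ba IH; have := fsubset_leq_card sCB => cB.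
have := card_pair_sums_add B a (leq_trans cC cB) Ba.
rewrite cardfsU1 (_ : a \notin B); first by lia.
by apply/negP => /Ba; rewrite ltxx.
Qed.

(** Pair sums are at most [u + v] in [C] and at least [u + v] in [Q], so they share at most this
    value. When [C] and [Q] cover [A] and share exactly [u] and [v], the excesses of [C] and [Q] add
    up to at most that of [A]. *)
Lemma card_pair_sums_split (A C Q : {fset int}) (u v : int) :
  C `<=` A -> Q `<=` A -> u < v ->
  (forall x, x \in C -> x = v \/ x <= u) ->
  (forall x, x \in Q -> x = u \/ v <= x) ->
  (#|` 2 ^^ C| + #|` 2 ^^ Q| <= #|` 2 ^^ A| + 1)%N.
Proof.
move=> sCA sQA uv Cu Qv; rewrite -cardfsUI leq_add //.
  apply: fsubset_leq_card; apply/fsubsetP => z; rewrite inE => /orP[].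
    by apply/fsubsetP/restricted_sumset_sub.
  by apply/fsubsetP/restricted_sumset_sub.
apply: (@leq_trans #|` [fset v + u]|); last by rewrite cardfs1.
apply: fsubset_leq_card; apply/fsubsetP => z.
rewrite in_fsetI in_fset1 => /andP[zC].
have le := pair_sums_le C v u z uv Cu zC; case/pair_sumP => x [y [/Qv xQ /Qv yQ xy zE]].
by clear -le xQ yQ xy zE uv; lia.
Qed.

(** If [B] lies in the class of [c] modulo [g], its pair sums are congruent to 2c, so an [a] outside
    the class creates |B| new sums. With the lower bound 2|B| - 3 for the old ones, this forces |B|
    <= e + 2. *)
Lemma pair_sums_lattice (C A : {fset int}) (e : nat) (c g : int) :
  C `<=` A -> (forall x y, x \in C -> y \in A -> y \notin C -> x < y) ->
  (e + 3 <= #|` C|)%N -> (forall x, x \in C -> (g %| x - c)%Z) ->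
  (#|` 2 ^^ A| + 3 <= 2 * #|` A| + e)%N ->
  forall x, x \in A -> (g %| x - c)%Z.
Proof.
move=> sCA Clt eC Cg.
apply: (fset_bottom_ind C A (fun B => (#|` 2 ^^ B| + 3 <= 2 * #|` B| + e)%N ->
  forall x, x \in B -> (g %| x - c)%Z) sCA Clt) => //.
move=> B a sCB _ _ Ba IH; have := fsubset_leq_card sCB => cB.
have aB : a \notin B by apply/negP => /Ba; rewrite ltxx.
rewrite cardfsU1 aB => eA; have c2 : (2 <= #|` B|)%N by lia.
have := card_pair_sums_add B a c2 Ba => up.
have {}IH : forall x, x \in B -> (g %| x - c)%Z by apply IH; lia.
suff ag : (g %| a - c)%Z by move=> x; rewrite !inE => /orP[/eqP->|/IH].
apply: contraT => ag.
have := card_pair_sums_add_max B B a Ba (fsubset_refl B) => /(_ _) new.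
have := card_restricted_sumset_ge 2 B c2.
suff : (#|` 2 ^^ B| + #|` B| <= #|` 2 ^^ (a |` B)|)%N by lia.
apply: new => x xB; apply: contra ag => /pair_sumP[y [z [yB zB _ E]]].
have -> : a - c = (y - c) + (z - c) - (x - c) by clear -E; lia.
by apply: rpredB; [apply: rpredD|]; apply: IH.
Qed.

(** The conclusion says that elements are at most |A| - 1 plus the excess of [A]. It is the
    invariant carried while [A] grows from [C]: a new maximum either keeps the set dense, so that
    [card_pair_sums_dense] applies, or creates too many sums. *)
Lemma pair_sums_extend (C A : {fset int}) (e : nat) :
  C `<=` A -> (forall x y, x \in C -> y \in A -> y \notin C -> x < y) ->
  (6 <= #|` C|)%N -> (e + 4 <= #|` C|)%N -> (e <= 3)%N ->
  0 \in C -> (forall x, x \in A -> 0 <= x) ->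
  (forall x, x \in C -> x <= #|` C|%:Z) ->
  (#|` 2 ^^ A| + 3 <= 2 * #|` A| + e)%N ->
  forall x, x \in A -> x + #|` A|%:Z <= #|` 2 ^^ A|%:Z + 2.
Proof.
move=> sCA Clt c6 ce e3 C0 A0 Cc.
apply: (fset_bottom_ind C A (fun B => (#|` 2 ^^ B| + 3 <= 2 * #|` B| + e)%N ->
  forall x, x \in B -> x + #|` B|%:Z <= #|` 2 ^^ B|%:Z + 2) sCA Clt) => //.
  move=> _ x xC; have [|n nC nmax] := fset_max C; first by lia.
  have := card_pair_sums_dense C n C0 nC => /(_ _ _) dense.
  have : n + #|` C|%:Z <= #|` 2 ^^ C|%:Z + 2.
    apply: dense; first by move=> y yC; rewrite A0 ?nmax // (fsubsetP sCA).
    by have := Cc n nC; lia.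
  by have := nmax x xC; lia.
move=> B a sCB sBA aA Ba IH; have := fsubset_leq_card sCB => cB.
have aB : a \notin B by apply/negP => /Ba; rewrite ltxx.
have B0 := fsubsetP sCB _ C0.
have Bge x : x \in B -> 0 <= x by move=> xB; apply: A0; apply: (fsubsetP sBA).
rewrite cardfsU1 aB => eA x xaB; have c2 : (2 <= #|` B|)%N.
  by clear -cB c6; lia.
have eB : (#|` 2 ^^ B| + 3 <= 2 * #|` B| + e)%N.
  by have up := card_pair_sums_add B a c2 Ba; clear -up eA; lia.
have {}IH : forall x, x \in B -> x + #|` B|%:Z <= #|` 2 ^^ B|%:Z + 2 := IH eB.
have xa : x <= a.
  by move: xaB; rewrite !inE => /orP[/eqP->//|/Ba/ltW].
apply: (@le_trans _ _ (a + (1 + #|` B|)%N%:Z)); first by rewrite lerD2r.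
have [small|big] := leP (a + 5) (2 * (1 + #|` B|)%N%:Z).
  have := card_pair_sums_dense (a |` B) a; rewrite cardfsU1 aB; apply=> //.
  - by rewrite !inE B0 orbT.
  - by rewrite !inE eqxx.
  - by move=> y; rewrite !inE => /orP[/eqP->|yB]; [rewrite A0 /=|rewrite Bge ?ltW ?Ba].
(* With j = |B|, at least j + a - b - b' - 1 new sums exceed b + b'; added to
   |2^B| >= b + j - 2 they give 2j - 3 + a - b', where a >= 2j - 2. *)
exfalso.
have [b [b' [bB b'B lt Bb]]] := fset_top2 B c2.
pose N : {fset int} := [fset x in B | b + b' < a + x].
have new : (#|` 2 ^^ B| + #|` N| <= #|` 2 ^^ (a |` B)|)%N.
  exact: card_pair_sums_add_top.
have sNB : N `<=` B by apply/fsubsetP => y; rewrite !inE => /andP[].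
(* Elements giving no new sum lie between 0 and [b + b' - a]. [Num.max] covers the case where this
   range is empty; then all of [B] gives new sums and the general bound [ge] suffices. *)
have cN : (#|` B `\` N| <= absz (Num.max 0 (b + b' - a + 1))%R)%N.
  apply: (card_fset_le _ 0) => y; rewrite !inE => /andP[yN yB].
  move: yN; rewrite yB /= -leNgt => yN; have y0 := Bge y yB.
  by clear -yN y0; lia.
have := cardfsDS sNB => cBN; have cNB := fsubset_leq_card sNB.
have ge := card_restricted_sumset_ge 2 B c2.
have bIH := IH b bB.
(* The count of sums would force b' >= 2|B| - e - 4. Up to one element beyond [C], the position of
   [C] bounds [b']; later the invariant at [b] does, thanks to [e <= 3]. *)
have b'B2 : b' + e%:Z + 4 < 2 * #|` B|%:Z.
  have [c0|[c1|c3]] : #|` B| = #|` C| \/ #|` B| = #|` C|.+1 \/ (#|` C|.+2 <= #|` B|)%N.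
  - by clear -cB; lia.
  - have BC : B = C by apply/eqP; rewrite eq_sym eqEfcard sCB c0 leqnn.
    have le : b <= #|` C|%:Z by apply: Cc; rewrite -BC.
    by clear -le lt c0 ce; lia.
  - have : #|` B `\` C| = 1%N by rewrite cardfsDS // c1 subSnn.
    case/eqP/cardfs1P => t BCt.
    have BC y : y \in B -> y \in C \/ y = t.
      move=> yB; have [|yC] := boolP (y \in C); first by left.
      by right; apply/eqP; rewrite -in_fset1 -BCt inE yC.
    have [tC tB] : t \notin C /\ t \in B.
      by apply/andP; rewrite -in_fsetD BCt in_fset1.
    have b'C : b' \in C.
      case: (BC b' b'B) => // b't; case: (BC b bB) => [bC|bt].
        by have := Clt _ _ bC (fsubsetP sBA _ tB) tC; rewrite -b't ltNge ltW.
      by move: lt; rewrite bt b't ltxx.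
    by have le := Cc b' b'C; clear -le c1 ce; lia.
  - by clear -bIH eB lt c3 ce e3; lia.
clear -new cN cBN cNB ge bIH b'B2 big eA eB cB ce c2 c6 e3 lt.
by case: (leP (b + b' - a + 1) 0) cN => ? cN; lia.
Qed.

(** The core [C] may have one hole. [pair_sums_lattice] puts [A] in the class of the core, and
    rescaling to minimum 0 and difference 1 gives the setting of [pair_sums_extend]. *)
Lemma pair_sums_within_core (C A : {fset int}) (e : nat) (g : int) :
  C `<=` A -> (forall x y, x \in C -> y \in A -> y \notin C -> x < y) ->
  (6 <= #|` C|)%N -> (e + 4 <= #|` C|)%N -> (e <= 3)%N ->
  within g #|` C|%:Z C -> (#|` 2 ^^ A| + 3 <= 2 * #|` A| + e)%N ->
  within g (#|` A|%:Z - 1 + e%:Z) A.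
Proof.
move=> sCA Clt c6 ce e3 [g0 Cg] eA; have gn0 : g != 0 by rewrite gt_eqF.
have [|a aC amin] := fset_min C; first by clear -c6; lia.
have aA := fsubsetP sCA _ aC.
have Amin x : x \in A -> a <= x.
  move=> xA; have [/amin//|xC] := boolP (x \in C).
  by rewrite ltW // (Clt a x aC).
have Ag x : x \in A -> (g %| x - a)%Z.
  apply: (pair_sums_lattice C A e a g sCA Clt _ _ eA); first by clear -ce; lia.
  by move=> y yC; have [] := Cg y a yC aC.
have [A1 AE] := lattice_affine a g A Ag.
move: sCA Clt Cg eA aC aA Amin c6 ce {amin Ag}; rewrite {}AE.
move=> /(sub_affine _ _ _ _ gn0)[C1 sCA ->] Clt Cg.
rewrite !card_affine // card_restricted_sumset_affine // => eA aC _ Amin c6 ce.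
have aE : a = a + g * 0 by rewrite mulr0 addr0.
have C0 : 0 \in C1 by rewrite -(mem_affine a g) // -aE.
have A0 x : x \in A1 -> 0 <= x.
  move=> xA; rewrite -(pmulr_rge0 x g0) -(lerDl a); apply: Amin.
  by rewrite mem_affine.
suff /(within_affine a g 1 _ _ gn0) : within 1 (#|` A1|%:Z - 1 + e%:Z) A1.
  by rewrite mulr1 gtr0_norm.
apply: (within_progression 0) => // x xA; exists x; last by rewrite mul1r add0r.
apply/andP; split; first exact: A0.
have := pair_sums_extend C1 A1 e sCA _ c6 ce e3 C0 A0 => ext.
have {ext} : x + #|` A1|%:Z <= #|` 2 ^^ A1|%:Z + 2.
  apply: ext => // y.
    move=> z yC zA zC; have := Clt (a + g * y) (a + g * z).
    by rewrite !mem_affine // ltrD2l ltr_pM2l //; apply.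
  move=> yC; have := Cg (a + g * y) (a + g * 0); rewrite !mem_affine //.
  move=> /(_ yC C0)[_]; rewrite card_affine // mulr0 addr0 addrC addKr.
  by rewrite ler_pM2l.
by clear -eA; lia.
Qed.

Lemma fset_bottom_affineN (A C : {fset int}) :
  C `<=` A -> (forall x y, x \in A -> x \notin C -> y \in C -> x < y) ->
  forall x y, x \in affine 0 (-1) C -> y \in affine 0 (-1) A ->
    y \notin affine 0 (-1) C -> x < y.
Proof.
move=> sCA Clt _ _ /affineP[x xC ->] /affineP[y yA ->].
by rewrite mem_affine // => yC; have := Clt y x yA yC xC; lia.
Qed.

Lemma pair_sums_within (A : {fset int}) (e : nat) :
  (e <= 3)%N -> (2 * e + 6 <= #|` A|)%N ->
  (#|` 2 ^^ A| + 3 <= 2 * #|` A| + e)%N ->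
  exists g, within g (#|` A|%:Z - 1 + e%:Z) A.
Proof.
(* [six_pair_sums] needs six elements and [pair_sums_extend] needs [e + 4]. For [e >= 2] there is
   room in [A] for a bottom and a top block of [c] elements sharing two. *)
move=> e3 cA eA; pose c := maxn 6 (e + 4).
have cbd : [/\ (6 <= c)%N, (e + 4 <= c)%N, (c <= 7)%N, (c <= #|` A|)%N &
             (2 <= e -> 2 * c <= #|` A| + 2)%N].
  by rewrite /c; clear -e3 cA; split; lia.
case: cbd => c6 ce c7 ccA c2; clearbody c.
(* A bottom block [Y] of excess at most 1 suffices: its six smallest elements have at most ten sums,
   and [pair_sums_within_core] leads from them to [Y] with excess 1, then from [Y] to [X] with
   excess [e]. *)
have core (X : {fset int}) (Y : {fset int}) :
    Y `<=` X -> (forall x y, x \in Y -> y \in X -> y \notin Y -> x < y) ->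
    #|` Y| = c -> (#|` 2 ^^ Y| + 3 <= 2 * c + 1)%N ->
    (#|` 2 ^^ X| + 3 <= 2 * #|` X| + e)%N ->
    exists g, within g (#|` X|%:Z - 1 + e%:Z) X.
  move=> sYX Ylt cY eY eX; suff [g Yg] : exists g, within g #|` Y|%:Z Y.
    by exists g; apply: pair_sums_within_core sYX Ylt _ _ _ Yg eX; rewrite ?cY.
  have [D [sDY cD Dlt]] : exists B : {fset int}, [/\ B `<=` Y, #|` B| = 6 &
      forall x y, x \in B -> y \in Y -> y \notin B -> x < y].
    by apply: fset_bottom; rewrite cY.
  have eD := card_pair_sums_bottom D Y sDY Dlt.
  have [|g Dg] := six_pair_sums D cD.
    by move: eD; rewrite cD cY => /(_ isT); clear -eY c6; lia.
  exists g; rewrite (_ : #|` Y|%:Z = #|` Y|%:Z - 1 + 1%N%:Z); last by rewrite subrK.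
  by apply: pair_sums_within_core sDY Dlt _ _ _ _ _; rewrite ?cD ?cY.
have [C [sCA cC Clt]] := fset_bottom A c ccA.
have [eC|eC] := leqP (#|` 2 ^^ C| + 3) (2 * c + 1); first exact: (core A C).
have eCA := card_pair_sums_bottom C A sCA Clt.
have e2 : (2 <= e)%N.
  move: eCA; rewrite cC => /(_ (leq_trans (isT : 2 <= 6)%N c6)).
  by clear -eC eA ccA; lia.
have [v [u [vC uC uv Cuv]]] := fset_top2 C ltac:(rewrite cC; clear -c6; lia).
(* [Q] keeps only [u] and [v] from [C]. Since [C] has excess at least 2, [Q] has at most [e - 2],
   hence at most 1, and so does its top block [D], which becomes the core after reflection. *)
pose Q : {fset int} := A `\` (C `\ u `\ v).
have sQA : Q `<=` A by apply: fsubsetDl.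
have cQ : (#|` Q| + c = #|` A| + 2)%N.
  have uvC : C `\ u `\ v `<=` A.
    apply: fsubset_trans sCA; apply: fsubset_trans (fsubD1set _ _) _.
    exact: fsubD1set.
  have neq : u != v by rewrite lt_eqF.
  have := cardfsD2 _ C u v uC vC neq; rewrite cC /Q (cardfsDS uvC).
  by clear -ccA; lia.
have Quv x : x \in Q -> x = u \/ v <= x.
  rewrite !inE => /andP[xC xA]; have [xCC|xCC] := boolP (x \in C).
    move: xC; rewrite xCC andbT -negb_or negbK => /orP[]/eqP->; last by left.
    by right.
  by right; rewrite ltW // (Clt v x vC).
have eCQ := card_pair_sums_split A C Q u v sCA sQA uv Cuv Quv.
have [|D0 [sDQ0 cD0 Dlt]] := fset_bottom Q (#|` Q| - c); first exact: leq_subr.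
pose D : {fset int} := Q `\` D0.
have sDQ : D `<=` Q by apply: fsubsetDl.
have sDA : D `<=` A := fsubset_trans sDQ sQA.
have cD : #|` D| = c.
  by rewrite cardfsDS // cD0 subKn //; move: (c2 e2); clear -cQ; lia.
have DQlt x y : x \in Q -> x \notin D -> y \in D -> x < y.
  move=> xA; rewrite in_fsetD xA andbT negbK => xD.
  by rewrite in_fsetD => /andP[yD yA]; apply: Dlt.
have Dtop x y : x \in A -> x \notin D -> y \in D -> x < y.
  move=> xA xD yD; have [xQ|] := boolP (x \in Q); first exact: DQlt.
  rewrite !inE xA andbT negbK => /and3P[xv xu xC].
  have xltu : x < u.
    by rewrite lt_neqAle xu; case: (Cuv x xC) xv => [->|//]; rewrite eqxx.
  case: (Quv y (fsubsetP sDQ _ yD)) => [->//|vy].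
  by apply: lt_le_trans vy; apply: lt_trans uv.
have g0 : (-1 : int) != 0 by [].
have eD : (#|` 2 ^^ D| + 2 * #|` Q| <= #|` 2 ^^ Q| + 2 * #|` D|)%N.
  have := card_pair_sums_bottom (affine 0 (-1) D) (affine 0 (-1) Q).
  rewrite (card_restricted_sumset_affine 2 0 (-1) D g0).
  rewrite (card_restricted_sumset_affine 2 0 (-1) Q g0).
  rewrite (card_affine 0 (-1) D g0) (card_affine 0 (-1) Q g0); apply.
  - exact: affine_sub.
  - exact: fset_bottom_affineN.
  - by rewrite cD; clear -c6; lia.
have [|||||g Ag] := core (affine 0 (-1) A) (affine 0 (-1) D).
- exact: affine_sub.
- exact: fset_bottom_affineN.
- by rewrite (card_affine 0 (-1) D g0).
- rewrite (card_restricted_sumset_affine 2 0 (-1) D g0); move: eD; rewrite cD.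
  by clear -eCQ eC eA cQ e3; lia.
- by rewrite (card_affine 0 (-1) A g0) (card_restricted_sumset_affine 2 0 (-1) A g0).
exists g; have := within_affine 0 (-1) g _ _ g0 Ag.
rewrite (card_affine 0 (-1) A g0) normrN1 mul1r.
rewrite (_ : affine 0 (-1) (affine 0 (-1) A) = A) //.
apply/fsetP => x; rewrite [x in LHS](_ : x = 0 + -1 * (0 + -1 * x)).
  by rewrite !mem_affine.
by rewrite !add0r !mulN1r opprK.
Qed.

(** * Sums of h elements *)

(** After rescaling, [A] and its translate by 1 both lie among the [L + 2] integers from 0 to
    [L + 1], so a dense [A] meets its translate. This recovers [g] from the set. *)
Lemma within_gap (g L : int) (A : {fset int}) :
  within g L A -> L + 2 < 2 * #|` A|%:Z -> (0 < #|` A|)%N ->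
  exists x y, [/\ x \in A, y \in A & x - y = g].
Proof.
move=> Ag LA A0; have [g0 _] := Ag; have gn0 : g != 0 by rewrite gt_eqF.
have [a aA amin] := fset_min A A0.
have [A1 AE A1L] := within_normalize a g L A Ag aA amin.
move: LA; rewrite AE (card_affine a g A1 gn0) => LA.
have cU : (#|` A1 `|` affine 1 1 A1| <= absz (L + 2)%R)%N.
  apply: (card_fset_le _ 0) => x; rewrite in_fsetU => /orP[/A1L|].
    by clear; lia.
  by case/affineP => y /A1L yL ->; clear -yL; lia.
have := cardfsUI A1 (affine 1 1 A1); rewrite (card_affine 1 1 A1) // => cUI.
have : (0 < #|` A1 `&` affine 1 1 A1|)%N.
  have L0 : 0 <= L.
    have : (0 < #|` A1|)%N by move: A0; rewrite AE (card_affine a g A1 gn0).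
    by rewrite cardfs_gt0 => /fset0Pn[x /A1L]; clear; lia.
  by clear -L0 cU cUI LA; lia.
rewrite cardfs_gt0 => /fset0Pn[x]; rewrite in_fsetI => /andP[xA /affineP[y yA xE]].
exists (a + g * x), (a + g * y); rewrite !mem_affine //; split=> //.
by rewrite xE mul1r mulrDr mulr1; lia.
Qed.

(** [m] and the [h] elements above [B] are the [h + 1] largest of [X]. Adding to them an element of
    [B] other than 0 and [m] gives the usual gain; density of [B] gives [d - 1] more sums, as if the
    holes below [d] were filled. *)
Lemma card_restricted_sumset_gap (h : nat) (X B : {fset int}) (d m : int) :
  0 \in X -> (forall x, x \in X -> 0 <= x) -> 0 < d ->
  (forall x, x \in X -> x != 0 -> d <= x) ->
  B `<=` X -> (forall x y, x \in B -> y \in X -> y \notin B -> x < y) ->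
  0 \in B -> m \in B -> (forall x, x \in B -> x <= m) ->
  (#|` B| + h = #|` X|)%N -> m + 5 <= 2 * #|` B|%:Z ->
  (#|` h.+1 ^^ (X `\ 0%R)| + (#|` B| - 2) + (absz d - 1) <= #|` h.+2 ^^ X|)%N.
Proof.
move=> X0 Xge d0 Xd sBX Blt B0 mB Bm cB cm.
have m0 : m != 0.
  apply/eqP => m0; suff : (#|` B| <= 1)%N by move: cm; rewrite m0; clear; lia.
  apply: (card_fset_le _ 0) => x xB; have := Bm x xB.
  by have := Xge x (fsubsetP sBX _ xB); rewrite m0; clear; lia.
have mX := fsubsetP sBX _ mB; have dm := Xd m mX m0.
pose R : {fset int} := X `\` B; pose Y : {fset int} := B `\ 0 `\ m.
have mR : m \notin R by rewrite in_fsetD mB.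
have cR : #|` R| = h by rewrite cardfsDS // -cB addKn.
have cY : (#|` Y| + 2 = #|` B|)%N by apply: cardfsD2 => //; rewrite eq_sym.
have YB x : x \in Y -> [/\ x \in B, x != 0 & x != m].
  by rewrite !in_fsetD !in_fset1 => /and3P[].
have cYI : #|` Y `|` int_range 1 (absz d - 1)| = (#|` B| - 2 + (absz d - 1))%N.
  rewrite cardfsU (_ : _ `&` _ = fset0).
    by rewrite cardfs0 card_int_range subn0 -cY addnK.
  apply/fsetP => x; rewrite in_fsetI in_fset0 in_int_range; apply/negP.
  case/andP => /YB[xB x0 _]; have := Xd x (fsubsetP sBX _ xB) x0.
  by clear -d0; lia.
(* For 0 < y < d, m + y is a sum of two elements of B: y is too small to be one. *)
rewrite -addnA -cYI.
apply: (card_restricted_sumset_step _ _ (m |` R) _ 0 m) => //.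
- apply/fsubsetP => x; rewrite in_fset1U => /orP[/eqP->//|].
  by rewrite in_fsetD => /andP[].
- by rewrite cardfsU1 mR cR.
- move=> x; rewrite in_fset1U => /orP[/eqP->//|].
  by rewrite in_fsetD => /andP[xB xX]; rewrite ltW // Blt.
- move=> x xX; rewrite in_fset1U in_fsetD xX andbT negb_or negbK => /andP[_].
  exact: Bm.
move=> y; rewrite in_fsetU => /orP[/YB[yB y0 ym]|].
  have yX := fsubsetP sBX _ yB; split; first by rewrite lt_neqAle eq_sym y0 Xge.
  apply: restricted_sumset_cons => //; apply/restricted_sumsetP.
  exists (m |` R); split=> //; last by rewrite cardfsU1 mR cR.
  apply/fsubsetP => x; rewrite in_fset1U in_fsetD1 => /orP[/eqP->|].
    by rewrite eq_sym ym.
  by rewrite in_fsetD => /andP[xB ->]; rewrite andbT; apply: contraNneq xB => ->.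
rewrite in_int_range => ybd; have yd : 0 < y < d by clear -ybd d0; lia.
split; first by case/andP: yd.
have ym : 0 < y < m by clear -yd dm; lia.
have Bbd x : x \in B -> 0 <= x <= m.
  by move=> xB; rewrite Bm ?Xge ?(fsubsetP sBX).
case/orP: (pair_sum_mod B m y B0 mB Bbd cm ym) => /pair_sumP[x [x' [xB x'B lt E]]].
  have x0 := Xge x (fsubsetP sBX _ xB).
  have := Xd x' (fsubsetP sBX _ x'B).
  by clear -x0 lt E yd; lia.
rewrite big_fsetU1 //= addrA [y + m]addrC E -addrA.
apply: restricted_sumset_cons; first exact: (fsubsetP sBX).
apply: restricted_sumset_cons.
  by rewrite in_fsetD1 gt_eqF //= (fsubsetP sBX).
apply/restricted_sumsetP; exists R; split=> //.
apply/fsubsetP => t; rewrite [t \in R]in_fsetD => /andP[tB tX].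
rewrite !in_fsetD1 tX andbT.
by apply/andP; split; apply: contraNneq tB => ->.
Qed.

(** Deleting the minimum or the maximum leaves excess at most [e]. The first deletion controls the
    width above the second smallest element; the second supplies the density that
    [card_restricted_sumset_gap] requires. *)
Lemma restricted_sumset_within (h : nat) (A : {fset int}) (e : nat) :
  (e <= 3)%N -> (h + 2 * e + 6 <= #|` A|)%N ->
  (#|` h.+2 ^^ A| <= h.+2 * (#|` A| - h.+2) + 1 + e)%N ->
  exists g, within g (#|` A|%:Z - 1 + e%:Z) A.
Proof.
elim: h A e => [|h IH] A e e3 cA eA.
  by apply: pair_sums_within; clear -eA cA e3; lia.
have [|a aA amin] := fset_min A; first by clear -cA; lia.
have [|z zA zmax] := fset_max A; first by clear -cA; lia.
have az : a != z.
  apply/eqP => az; suff : (#|` A| <= 1)%N by clear -cA; lia.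
  by apply: (card_fset_le _ a) => x xA; have := amin x xA; have := zmax x xA;
    rewrite -az; clear; lia.
have cAa : (1 + #|` A `\ a| = #|` A|)%N by rewrite (cardfsD1 a A) aA.
have cAz : (1 + #|` A `\ z| = #|` A|)%N by rewrite (cardfsD1 z A) zA.
have cAaz := cardfsD2 _ A a z aA zA az.
have hA : (h.+2 < #|` A|)%N by clear -cA; lia.
have Sa := card_restricted_sumsetD_min h.+2 A a aA amin hA.
have Sz := card_restricted_sumsetD_max h.+2 A z zA zmax hA.
have Sge := card_restricted_sumset_ge h.+2 (A `\ a) ltac:(clear -cA cAa; lia).
(* [N] is the least possible number of sums without [a]. The exact excess [e'] over it is kept,
   since the gap has to be paid from [e - e']. *)
pose N := (h.+2 * (#|` A `\ a| - h.+2) + 1)%N.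
have NE : (N + (#|` A| - h.+3) = h.+3 * (#|` A| - h.+3) + 1)%N.
  rewrite /N (_ : #|` A `\ a| - h.+2 = #|` A| - h.+3)%N; last by rewrite -cAa.
  by rewrite [in RHS]mulSn; clear; lia.
have [e' e'E] : exists e', #|` h.+2 ^^ (A `\ a)| = (N + e')%N.
  by exists (#|` h.+2 ^^ (A `\ a)| - N)%N; rewrite subnKC.
have e'e : (e' <= e)%N by move: Sa; rewrite e'E; clear -NE eA; lia.
have [||g1 W1] := IH (A `\ a) e' (leq_trans e'e e3).
- by clear -cAa cA e'e; lia.
- by rewrite e'E.
have [||g2 W2] := IH (A `\ z) e e3.
- by clear -cAz cA; lia.
- have NzE : N = (h.+2 * (#|` A `\ z| - h.+2) + 1)%N.
    by rewrite /N; congr (_ * (_ - _) + _)%N; clear -cAa cAz; lia.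
  by move: Sz; rewrite -NzE; clear -NE eA; lia.
pose X : {fset int} := A `\ a `\ z.
have sXa : X `<=` A `\ a by apply: fsubD1set.
have sXz : X `<=` A `\ z.
  by apply/fsubsetP => x; rewrite !in_fsetD1 => /and3P[-> _].
have X0 : (0 < #|` X|)%N by rewrite /X; clear -cAaz cA; lia.
have [g10 _] := W1; have [g20 _] := W2.
(* [X] is dense in both progressions, so each difference occurs between two elements of [X] and is
   divisible by the other. *)
have gE : g1 = g2.
  have [|x [y [xX yX E1]]] := within_gap _ _ X (within_sub _ _ _ _ sXa W1) _ X0.
    by rewrite /X; clear -cAaz cA cAa e'e; lia.
  have [|x' [y' [xX' yX' E2]]] := within_gap _ _ X (within_sub _ _ _ _ sXz W2) _ X0.
    by rewrite /X; clear -cAaz cA cAz; lia.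
  have d21 : (g2 %| g1)%Z.
    by rewrite -E1; have [] := W2.2 x y (fsubsetP sXz _ xX) (fsubsetP sXz _ yX).
  have d12 : (g1 %| g2)%Z.
    by rewrite -E2; have [] := W1.2 x' y' (fsubsetP sXa _ xX') (fsubsetP sXa _ yX').
  have : `|g1|%N = `|g2|%N by apply/eqP; rewrite eqn_dvd -!dvdzE d12 d21.
  by clear -g10 g20; lia.
move: g20 W2; rewrite -{}gE => _ W2; move: g1 g10 W1 W2 => g g0 W1 W2.
have gn0 : g != 0 by rewrite gt_eqF.
have zAa : z \in A `\ a by rewrite in_fsetD1 eq_sym az.
have aAz : a \in A `\ z by rewrite in_fsetD1 az.
have Ag x : x \in A -> (g %| x - a)%Z.
  move=> xA; have [->|xz] := eqVneq x z; last first.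
    by have [] := W2.2 x a _ aAz; rewrite // in_fsetD1 xz.
  move: X0; rewrite cardfs_gt0 => /fset0Pn[w wX].
  have [dzw _] := W1.2 z w zAa (fsubsetP sXa _ wX).
  have [dwa _] := W2.2 w a (fsubsetP sXz _ wX) aAz.
  by rewrite -[z](subrK w) -addrA; apply: rpredD.
have [A1 AE] := lattice_affine a g A Ag.
have aE : a = a + g * 0 by rewrite mulr0 addr0.
have memA q : (a + g * q \in A) = (q \in A1) by rewrite AE mem_affine.
have cA1 : #|` A| = #|` A1| by rewrite AE (card_affine a g A1 gn0).
have SE : #|` h.+3 ^^ A| = #|` h.+3 ^^ A1|.
  by rewrite AE (card_restricted_sumset_affine _ a g A1 gn0).
have SaE : #|` h.+2 ^^ (A `\ a)| = #|` h.+2 ^^ (A1 `\ 0%R)|.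
  have -> : A `\ a = affine a g (A1 `\ 0).
    by rewrite AE -(affineD1 a g A1 0 gn0) -aE.
  exact: card_restricted_sumset_affine.
have A10 : 0 \in A1 by rewrite -memA -aE.
have A1ge q : q \in A1 -> 0 <= q.
  by rewrite -memA => /amin; rewrite lerDl pmulr_rge0.
have [n zE] : exists n, z = a + g * n.
  by move: (zA); rewrite {1}AE => /affineP[n _ ->]; exists n.
have nA1 : n \in A1 by rewrite -memA -zE.
have A1n q : q \in A1 -> q <= n.
  by rewrite -memA => /zmax; rewrite zE lerD2l ler_pM2l.
have cA10 : (1 + #|` A1 `\ (0 : int)| = #|` A1|)%N.
  by rewrite (cardfsD1 (0 : int) A1) A10.
have [|d dA1 dmin] := fset_min (A1 `\ (0 : int)).
  by clear -cA cA1 cA10; lia.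
move: dA1; rewrite in_fsetD1 => /andP[d0 dA1].
have d_gt0 : 0 < d by rewrite lt_neqAle eq_sym d0 A1ge.
have nd : n - d <= #|` A|%:Z - 2 + e'%:Z.
  have dAa : a + g * d \in A `\ a.
    by rewrite in_fsetD1 memA dA1 [X in _ != X]aE (inj_eq (affine_inj a g gn0)) d0.
  have [_] := W1.2 z _ zAa dAa; rewrite zE opprD addrACA subrr add0r -mulrBr.
  by rewrite ler_pM2l //; clear -cAa; lia.
have nonmax q : q \in A1 -> q != n -> q <= #|` A|%:Z - 2 + e%:Z.
  move=> qA qn; have qAz : a + g * q \in A `\ z.
    by rewrite in_fsetD1 memA qA zE (inj_eq (affine_inj a g gn0)) qn.
  have [_] := W2.2 _ a qAz aAz; rewrite addrC addKr ler_pM2l //.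
  by clear -cAz; lia.
have [|B [sBA cB Blt]] := fset_bottom A1 (#|` A| - h.+1).
  by rewrite cA1 leq_subr.
have [|m mB Bm] := fset_max B; first by rewrite cB; clear -cA; lia.
have B0 : 0 \in B.
  apply: contraT => B0; have := Blt m 0 mB A10 B0.
  by rewrite ltNge A1ge // (fsubsetP sBA).
have cAB : #|` A1 `\` B| = h.+1.
  by rewrite cardfsDS // cB cA1 subKn // -cA1; clear -cA; lia.
have nB : n \notin B.
  apply/negP => nB; have : (0 < #|` A1 `\` B|)%N by rewrite cAB.
  rewrite cardfs_gt0 => /fset0Pn[y]; rewrite in_fsetD => /andP[yB yA].
  by have := Blt n y nB yA yB; rewrite ltNge A1n.
have mA1 := fsubsetP sBA _ mB.
have mle : m <= #|` A|%:Z - 2 + e%:Z.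
  by apply: nonmax => //; apply: contraNneq nB => <-.
(* Besides [n], the [h] elements above [B] lie above [m] and up to |A| - 2 + e; this pushes [m] down
   by [h] and makes [B] dense. *)
have mh : (h <= absz (#|` A|%:Z - 2 + e%:Z - m)%R)%N.
  have := cardfsD1 n (A1 `\` B); rewrite in_fsetD nB nA1 cAB => -[->].
  apply: (card_fset_le _ (m + 1)) => q; rewrite in_fsetD1 in_fsetD.
  case/and3P => qn qB qA; have := nonmax q qA qn; have := Blt m q mB qA qB.
  by clear -mle; lia.
have cm : m + 5 <= 2 * #|` B|%:Z by rewrite cB; clear -mh mle cA; lia.
have := card_restricted_sumset_gap h.+1 A1 B d m A10 A1ge d_gt0.
move=> /(_ _ sBA Blt B0 mB Bm _ cm) gap.
have {gap} : (N + e' + (#|` A| - h.+3) + (absz d - 1) <= #|` h.+3 ^^ A|)%N.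
  rewrite SE -e'E SaE (_ : #|` A| - h.+3 = #|` B| - 2)%N; last first.
    by rewrite cB; clear; lia.
  apply: gap; last by rewrite cB -cA1 subnK //; clear -cA; lia.
  by move=> q qA q0; apply: dmin; rewrite in_fsetD1 q0.
move=> gap.
(* Hence n <= d + |A| - 2 + e' <= |A| - 1 + e, the required width. *)
have ed : (e' + (absz d - 1) <= e)%N.
  by move: NE gap eA; clearbody N; clear; lia.
exists g; apply: (within_progression a) => // x.
rewrite {1}AE => /affineP[q qA ->]; exists q => //.
apply/andP; split; first exact: A1ge.
by have := A1n q qA; clear -ed nd d_gt0; lia.
Qed.

Lemma restricted_sumset_bound (h k e : nat) (A : {fset int}) :
  (3 <= h)%N -> #|` A| = k -> is_min A 0 -> gcd_fset A = 1%N ->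
  (e <= 3)%N -> (h + 2 * e + 4 <= k)%N ->
  #|` h ^^ A|%:Z = h%:Z * k%:Z - h%:Z ^+ 2 + (1 + e%:Z) ->
  {subset A <= `[0, k%:Z - 1 + e%:Z]}.
Proof.
case: h => [|[|h]] // h3 <- [A0 Amin] gcdA e3 cA SE.
have [||g [g0 Ag]] := restricted_sumset_within h A e e3.
- by clear -cA; lia.
- move: SE; rewrite expr2 -mulrBr; clear -cA.
  rewrite (_ : #|` A|%:Z - h.+2%:Z = (#|` A| - h.+2)%N%:Z); first by lia.
  by rewrite subzn //; lia.
(* As 0 is in [A], the difference [g] divides every element, hence the gcd. *)
have g1 : g = 1.
  have : (`|g| %| gcd_fset A)%N.
    rewrite /gcd_fset big_seq; elim/big_ind: _ => [|m n gm gn|x xA].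
    - exact: dvdn0.
    - by rewrite dvdn_gcd gm.
    - by have [] := Ag x 0 xA A0; rewrite subr0.
  by rewrite gcdA dvdn1; clear -g0; lia.
move=> x xA; have [_] := Ag x 0 xA A0; rewrite g1 subr0 mul1r => le.
by rewrite in_itv /= Amin.
Qed.

Theorem theorem1p9 (h k : nat) (A : {fset int})
    (h_ge3 : (3 <= h)%N) (k_gt0 : (0 < k)%N)
    (card_A : #|` A| = k) (min_A : is_min A 0) (gcd_A : gcd_fset A = 1%N) :
  [/\ (3 * h + 1 <= k)%N ->
      #|` restricted_sumset h A|%:Z = h%:Z * k%:Z - h%:Z ^+ 2 + 2 ->
      {subset A <= `[0, k%:Z]},
      (3 * h + 3 <= k)%N ->
      #|` restricted_sumset h A|%:Z = h%:Z * k%:Z - h%:Z ^+ 2 + 3 ->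
      {subset A <= `[0, k%:Z + 1]}
    & (3 * h + 4 <= k)%N ->
      #|` restricted_sumset h A|%:Z = h%:Z * k%:Z - h%:Z ^+ 2 + 4 ->
      {subset A <= `[0, k%:Z + 2]}].
Proof.
(* The three cases are [e] = 1, 2, 3. For [h >= 3] each size hypothesis gives h + 2e + 4 <= k, with
   nothing to spare when [e] = 3 and [h] = 3. *)
have bound e := restricted_sumset_bound h k e A h_ge3 card_A min_A gcd_A.
split=> hk SE x xA.
- have := bound 1%N isT _ SE x xA; rewrite subrK; apply; lia.
- have := bound 2%N isT _ SE x xA; rewrite -addrA; apply; lia.
- have := bound 3%N isT _ SE x xA; rewrite -addrA; apply; lia.
Qed.
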